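(* Let $x, y \in \mathbb{R}^n$ be vectors of unit Euclidean norm, and let $\Omega \in \mathbb{R}^{s \times n}$ be a Gaussian sketching matrix. Then for $s \ge 2$ and any $\delta > 0$ the following hold: (a) if $x \ne y$, then $$\mathbb{P}\big( |\langle \Omega x, \Omega y\rangle| \le \delta \big) \le 202\, s\, \delta;$$ (b) if $x = y$, then $$\mathbb{P}\big( |\langle \Omega x, \Omega y\rangle| \le \delta \big) \le \big(\delta e^{1-\delta}\big)^{s/2}.$$
   Context: $\langle u, v\rangle = u^T v$ denotes the Euclidean inner product. A Gaussian sketching matrix $\Omega \in \mathbb{R}^{s\times n}$ is the random matrix $\Omega = \frac{1}{\sqrt{s}}[\omega_1, \dots, \omega_s]^T$, where $\omega_1, \dots, \omega_s \in \mathbb{R}^n$ are independent standard Gaussian random vectors; equivalently, the entries of $\Omega$ are i.i.d. $\mathcal{N}(0, 1/s)$.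
   Formalization: Part (b) is proved for 0 < δ ≤ 1 only; as written for every δ > 0 it is false: at δ = 4 the probability is at least 3/4 by Markov's inequality, while the claimed bound is at most 4e^{-3} < 0.2 for every s ≥ 2. *)

(* Defs.v *)
From HB Require Import structures.
From mathcomp Require Export all_boot all_order all_algebra.
From mathcomp Require Export all_classical all_reals all_analysis.

Set Implicit Arguments.
Unset Strict Implicit.
Unset Printing Implicit Defensive.
Import Order.TTheory GRing.Theory Num.Theory.
Import numFieldNormedType.Exports.

Local Open Scope classical_set_scope.
Local Open Scope ring_scope.

Section euclidean.
Context {R : realType} {n : nat}.

Definition inner (u v : 'cV[R]_n) : R := (u^T *m v) ord0 ord0.

(* The library norm `|u| on matrices is the sup norm. *)
Definition enorm (u : 'cV[R]_n) : R := Num.sqrt (inner u u).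

End euclidean.

Section gaussian.
Context {d : measure_display} {T : measurableType d} {R : realType}
  (P : probability T R).

Definition mutually_independent (I : finType) (d' : measure_display)
    (T' : measurableType d') (X : I -> T -> T') : Prop :=
  forall (J : {set I}) (A : I -> set T'),
    (forall i, measurable (A i)) ->
    P (\bigcap_(i in [set` J]) (X i @^-1` A i)) =
    (\prod_(i in J) P (X i @^-1` A i))%E.

(* Random vectors are valued in n.-tuple R, which the library equips with the
   sigma-algebra generated by the coordinates, i.e. the Borel sets of R^n.
   The second argument of normal_prob is the standard deviation. *)
Definition standard_gaussian_vector (n : nat) (g : {RV P >-> n.-tuple R}) :
    Prop :=
  (forall (j : 'I_n) (A : set R), measurable A ->
     P ((fun t => tnth (g t) j) @^-1` A) = normal_prob 0 1 A) /\
  mutually_independent (fun (j : 'I_n) (t : T) => tnth (g t) j).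

Definition gaussian_sketching_matrix (s n : nat) (Omega : T -> 'M[R]_(s, n)) :
    Prop :=
  exists omega : 'I_s -> {RV P >-> n.-tuple R},
    [/\ forall i, standard_gaussian_vector (omega i),
        mutually_independent (fun (i : 'I_s) (t : T) => omega i t) &
        forall t, Omega t =
          (Num.sqrt s%:R)^-1 *: \matrix_(i < s, j < n) tnth (omega i t) j].

End gaussian.

(* Main.v *)
Require Import Defs.
From HB Require Import structures.
From mathcomp Require Import all_boot all_order all_algebra.
From mathcomp Require Import all_classical all_reals all_analysis.
From mathcomp Require Import measurable_realfun ring lra.
Import Order.TTheory GRing.Theory Num.Theory.
Import numFieldNormedType.Exports.
Local Open Scope classical_set_scope.
Local Open Scope ring_scope.

(** Let [omega_i] be the rows of the sketch before scaling by [1 / sqrt s], so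
    that [<Omega x, Omega y> = s^-1 * sum_i <omega_i, x> <omega_i, y>].

    Case [x <> y].  Polarization turns each summand into a quarter of
    [<omega_i, u>^2 - <omega_i, v>^2] with [{u, v} = {x + y, x - y}].  Because
    [x] and [y] are unit vectors, [u] and [v] are orthogonal and
    [|u|^2 + |v|^2 = 4]; name them so that [|u|^2 >= 2], at the price of a sign
    that the absolute value absorbs ([quad_polarization]).  Under the standard
    Gaussian law the two coordinates [<omega, u>] and [<omega, v>] are
    independent centred normals with deviations [|u|] and [|v|] ([lin_law]).
    Freeze everything except the [u]-coordinates of two rows: what remains
    random is [|u|^2 (X^2 + Y^2)] plus a constant, and the planar Gaussian gives
    an annulus [l <= X^2 + Y^2 <= l + h] mass at most [2 h] uniformly in [l]
    ([normal_annulus]).  Two rows are what it takes, since the density of a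
    single [X^2] blows up at the origin.  Integrating the frozen variables back
    gives the bound [8 s delta].

    The joint law of two linear forms is found by induction on the dimension,
    each step merging one coordinate into a normal form by planar rotations.
    That rotations preserve the planar Gaussian follows from the same statement
    for Lebesgue measure ([lebesgue_rotation]): a rotation is a product of three
    shears, and a shear is a translation on every line.

    Case [x = y].  Now [<omega_i, x>] is standard normal, and Markov's inequality
    for [exp (lambda (s delta - sum_i <omega_i, x>^2))] with
    [lambda = (1 / delta - 1) / 2] gives the claim ([lin_chernoff]): this
    [lambda] makes [exp (- lambda X^2)] have mean [sqrt delta], by comparison of
    the densities of [N(0, 1)] and [N(0, delta)].

    All independence is used through one device: a family of mutually
    independent variables with a common law [nu] is distributed as the iterated
    product [iid nu n] ([iid_law]), whose integrals unfold one variable at a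
    time ([ge0_integral_iidS]).  It serves both for the coordinates of a row and
    for the rows. *)

(** * Rotation invariance of the planar Gaussian *)

Section gauss.
Context {R : realType}.
Local Notation mu := (@lebesgue_measure R).
Local Notation gamma := (@normal_prob R 0 1).
Local Notation phi := (@normal_pdf R 0 1).
Local Open Scope ereal_scope.

(** [normal_pdf 0 1] is a Radon-Nikodym derivative of [normal_prob 0 1], so the
    change of variables for such derivatives applies. *)
Lemma ge0_integral_normal_prob (f : R -> \bar R) :
  measurable_fun setT f -> (forall x, 0 <= f x) ->
  \int[gamma]_x f x = \int[mu]_x (f x * (phi x)%:E).
Proof.
move=> mf f0.
have dom := @normal_prob_dominates R 0 1.
rewrite -(Radon_Nikodym_SigmaFinite.change_of_variables dom)//.
apply: ae_eq_integral => //.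
- apply: emeasurable_funM => //; apply: (measurable_int mu).
  exact: Radon_Nikodym_SigmaFinite.f_integrable.
- apply: emeasurable_funM => //=; apply/measurableT_comp => //=.
  exact: measurable_normal_pdf.
- apply: ae_eqe_mul2l => /=.
  apply: integral_ae_eq => //=.
  + exact: Radon_Nikodym_SigmaFinite.f_integrable.
  + by apply/measurableT_comp =>//; exact: measurable_normal_pdf.
  + by move=> E _ mE; rewrite -Radon_Nikodym_SigmaFinite.f_integral.
Qed.

Lemma lebesgue_measureD (t : R) (A : set R) : measurable A ->
  pushforward mu ((fun x => x + t)%R : _ -> measurableTypeR R) A = mu A.
Proof.
move=> mA; apply/esym/lebesgue_measure_unique => //.
  exact: measurable_funD.
move=> mt _ [[a b]] _ <-; rewrite /= /pushforward.
have -> : (fun x : R => x + t)%R @^-1` `]a, b] = `](a - t)%R, (b - t)%R]%classic.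
  by apply/seteqP; split => x /=; rewrite !in_itv/= lerBrDr ltrBlDr.
rewrite !lebesgue_measure_itv/= !lte_fin ltrD2r -!EFinD.
by case: ifP => // _; congr EFin; lra.
Qed.

Lemma ge0_integral_lebesgueD (t : R) (f : R -> \bar R) :
  measurable_fun setT f -> (forall x, 0 <= f x) ->
  \int[mu]_x f (x + t)%R = \int[mu]_x f x.
Proof.
move=> mf f0.
transitivity
  (\int[pushforward mu ((fun x => x + t)%R : _ -> measurableTypeR R)]_x f x).
  by rewrite ge0_integral_pushforward//; exact: measurable_funD.
apply: eq_measure_integral; first exact: measurable_funD. 
by move=> mt A mA _; exact: lebesgue_measureD.
Qed.

Lemma lebesgue_shear (t : R) (f : R * R -> \bar R) :
  measurable_fun setT f -> (forall z, 0 <= f z) ->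
   \int[mu]_x \int[mu]_y f (x, y + t * x)%R = \int[mu]_x \int[mu]_y f (x, y).
Proof.
move=> mf f0; apply: eq_integral => x _.
rewrite (ge0_integral_lebesgueD (t * x)%R (fun y => f (x, y)))//.
exact: measurableT_comp.
Qed.

Lemma measurable_lin2 d (T : measurableType d) (f g : T -> R) (a b : R) :
  measurable_fun setT f -> measurable_fun setT g ->
  measurable_fun setT (fun z => a * f z + b * g z)%R.
Proof.
by move=> mf mg; apply: measurable_funD; apply: measurable_funM.
Qed.

(** With [t = tan (theta / 2) = s / (1 + c)], the rotation is the composite of
    [(x, y) |-> (x - t y, y)], [(x, y) |-> (x, y + s x)] and again
    [(x, y) |-> (x - t y, y)].  The hypothesis [0 <= c] keeps [t] finite. *)
Lemma lebesgue_rotation (c s : R) (f : R * R -> \bar R) :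
  measurable_fun setT f -> (forall z, 0 <= f z) ->
  (0 <= c)%R -> (c ^+ 2 + s ^+ 2 = 1)%R ->
   \int[mu]_x \int[mu]_y f (c * x - s * y, s * x + c * y)%R =
   \int[mu]_x \int[mu]_y f (x, y).
Proof.
move=> mf f0 c0 cs1.
pose t := (s / (1 + c))%R.
have c1 : (1 + c != 0)%R by rewrite gt_eqF// ltr_wpDr.
have tE : (t * (1 + c) = s)%R by rewrite /t divfK.
have tE2 : (t * s = 1 - c)%R.
  rewrite /t mulrAC -expr2; apply: (mulIf c1); rewrite divfK//.
  by rewrite -[in LHS](addKr (c ^+ 2) (s ^+ 2))%R cs1; ring.
pose f1 := fun z : R * R => f (z.1 - t * z.2, z.2)%R.
pose f2 := fun z : R * R => f1 (z.1, z.2 + s * z.1)%R.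
have f10 z : 0 <= f1 z by exact: f0.
have f20 z : 0 <= f2 z by exact: f0.
have mpair (a b : R * R -> R) (h : R * R -> \bar R) :
    measurable_fun setT h -> measurable_fun setT a -> measurable_fun setT b ->
    measurable_fun setT (fun z => h (a z, b z)).
  move=> mh ma mb; apply: measurableT_comp => //.
  exact: measurable_fun_pair.
have mf1 : measurable_fun setT f1.
  apply: mpair => //.
  by apply: measurable_funB => //; apply: measurable_funM.
have mf2 : measurable_fun setT f2.
  by apply: mpair => //; apply: measurable_funD => //; apply: measurable_funM.
have fub (h : R * R -> \bar R) : measurable_fun setT h -> (forall z, 0 <= h z) ->
    \int[mu]_x \int[mu]_y h (x, y) = \int[mu]_y \int[mu]_x h (x, y).
  by move=> mh h0; exact: fubini_tonelli.
transitivity (\int[mu]_y \int[mu]_x f2 (x - t * y, y)%R).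
  rewrite (fub (fun z => f (c * z.1 - s * z.2, s * z.1 + c * z.2)%R)).
  - apply: eq_integral => y _; apply: eq_integral => x _.
    rewrite /f2 /f1 /=; congr (f (_, _)).
    + transitivity (x - t * s * x - (t * (1 + (1 - t * s))) * y)%R; last by ring.
      rewrite tE2 -tE; congr (_ - _)%R; first by ring.
      by congr (_ * _)%R; ring.
    + transitivity (s * x + (1 - t * s) * y)%R; last by ring.
      by rewrite tE2; congr (_ + _)%R; ring.
  - by apply: mpair => //; [apply: measurable_funB|apply: measurable_funD] => //;
      apply: measurable_funM.
  - by [].
transitivity (\int[mu]_y \int[mu]_x f2 (x, y)).
  apply: eq_integral => y _.
  rewrite (ge0_integral_lebesgueD (- (t * y))%R (fun x => f2 (x, y)))//.
  exact: measurableT_comp.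
transitivity (\int[mu]_x \int[mu]_y f2 (x, y)); first exact: (esym (fub f2 mf2 f20)).
rewrite (lebesgue_shear s f1 mf1 f10).
transitivity (\int[mu]_y \int[mu]_x f1 (x, y)); first exact: (fub f1 mf1 f10).
transitivity (\int[mu]_y \int[mu]_x f (x, y)); last exact: (esym (fub f mf f0)).
apply: eq_integral => y _.
rewrite (ge0_integral_lebesgueD (- (t * y))%R (fun x => f (x, y)))//.
exact: measurableT_comp.
Qed.

Lemma normal_pdf_rotation (c s x y : R) : (c ^+ 2 + s ^+ 2 = 1)%R ->
  (phi (c * x - s * y) * phi (s * x + c * y) = phi x * phi y)%R.
Proof.
move=> cs1.
rewrite !normal_pdfE ?oner_neq0// /normal_fun.
rewrite [LHS]mulrACA [RHS]mulrACA; congr (_ * _)%R.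
rewrite -!expRD; congr expR; rewrite !subr0 -!mulrDl; congr (_ * _)%R.
transitivity (- ((c ^+ 2 + s ^+ 2) * (x ^+ 2 + y ^+ 2)))%R; first by ring.
by rewrite cs1; ring.
Qed.

(** The Lebesgue case applies because the density depends only on
    [x ^+ 2 + y ^+ 2]. *)
Lemma normal_rotation (c s : R) (f : R * R -> \bar R) :
  measurable_fun setT f -> (forall z, 0 <= f z) ->
  (0 <= c)%R -> (c ^+ 2 + s ^+ 2 = 1)%R ->
   \int[gamma]_x \int[gamma]_y f (c * x - s * y, s * x + c * y)%R =
   \int[gamma]_x \int[gamma]_y f (x, y).
Proof.
move=> mf f0 c0 cs1.
have key (h : R * R -> \bar R) : measurable_fun setT h -> (forall z, 0 <= h z) ->
    \int[gamma]_x \int[gamma]_y h (x, y) =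
    \int[mu]_x \int[mu]_y (h (x, y) * (phi x * phi y)%:E).
  move=> mh h0; rewrite ge0_integral_normal_prob.
  - apply: eq_integral => x _; rewrite ge0_integral_normal_prob//.
    + rewrite -ge0_integralZr//.
      * by apply: eq_integral => y _; rewrite EFinM muleA muleAC.
      * apply: emeasurable_funM; first exact: measurableT_comp.
        by apply/measurable_EFinP; exact: measurable_normal_pdf.
      * by move=> y _; rewrite mule_ge0// lee_fin normal_pdf_ge0.
      * by rewrite lee_fin normal_pdf_ge0.
    + exact: measurableT_comp.
  - exact: (@measurable_fun_fubini_tonelli_F _ _ _ _ _ gamma h).
  - by move=> x; apply: integral_ge0.
have mg : measurable_fun setT
    (fun z : R * R => f (c * z.1 - s * z.2, s * z.1 + c * z.2)%R).
  apply: measurableT_comp => //; apply: measurable_fun_pair.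
    by apply: measurable_funB => //; apply: measurable_funM.
  by apply: measurable_funD => //; apply: measurable_funM.
rewrite [RHS](key f mf f0).
rewrite (key (fun z => f (c * z.1 - s * z.2, s * z.1 + c * z.2)%R) mg (fun=> f0 _)).
rewrite -(lebesgue_rotation c s (fun z => f z * (phi z.1 * phi z.2)%:E)).
- apply: eq_integral => x _; apply: eq_integral => y _ /=.
  by rewrite normal_pdf_rotation.
- apply: emeasurable_funM => //; apply/measurable_EFinP.
  by apply: measurable_funM; apply: measurableT_comp => //; exact: measurable_normal_pdf.
- by move=> z; rewrite mule_ge0// lee_fin mulr_ge0// normal_pdf_ge0.
- by [].
- by [].
Qed.

End gauss.

(** * The law of an independent, identically distributed family *)

Section iid.
Context {d} {U : measurableType d} {R : realType} (nu : probability U R).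

Definition tuple_cons {n} (p : U * n.-tuple U) : n.+1.-tuple U :=
  [tuple of p.1 :: p.2].

Lemma measurable_tuple_cons n : measurable_fun setT (@tuple_cons n).
Proof. exact: measurable_cons. Qed.

HB.instance Definition _ n :=
  isMeasurableFun.Build _ _ _ _ (@tuple_cons n) (@measurable_tuple_cons n).

(** Built as the image of [nu \x iid nu n] under [tuple_cons], so that Fubini
    applies to the first variable. *)
Fixpoint iid n : probability (n.-tuple U) R :=
  match n with
  | 0 => \d_[tuple]
  | m.+1 => distribution (nu \x iid m)%E (@tuple_cons m)
  end.

Local Open Scope ereal_scope.

Lemma ge0_integral_iidS n (f : n.+1.-tuple U -> \bar R) :
  measurable_fun setT f -> (forall w, 0 <= f w) ->
  \int[iid n.+1]_w f w = \int[nu]_x \int[iid n]_w f (tuple_cons (x, w)).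
Proof.
move=> mf f0 /=.
rewrite ge0_integral_distribution//.
rewrite fubini_tonelli1//; first exact: measurableT_comp.
by move=> z; exact: f0.
Qed.

Definition box {n} (A : 'I_n -> set U) : set (n.-tuple U) :=
  [set w | forall i, A i (tnth w i)].

Lemma measurable_box n (A : 'I_n -> set U) :
  (forall i, measurable (A i)) -> measurable (box A).
Proof.
move=> mA; rewrite (_ : box A = \bigcap_(i in [set: 'I_n]) ((@tnth n U)^~ i @^-1` A i)).
  apply: fin_bigcap_measurable => //= i _.
  by rewrite -[X in measurable X]setTI; exact: measurable_tnth.
by apply/seteqP; split => w /= h i => [_|]; exact: (h i).
Qed.

Lemma box_cons n (A : 'I_n.+1 -> set U) :
  @tuple_cons n @^-1` box A = A ord0 `*` box (fun i => A (lift ord0 i)).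
Proof.
apply/seteqP; split => -[x w] /=.
  move=> h; split; first exact: (h ord0).
  by move=> i; have := h (lift ord0 i); rewrite /tuple_cons tnthS.
move=> [h0 h] i; case: (unliftP ord0 i) => [j|] ->; last exact: h0.
by rewrite /tuple_cons tnthS; exact: h.
Qed.

Lemma iid_box n (A : 'I_n -> set U) : (forall i, measurable (A i)) ->
  iid n (box A) = \prod_(i < n) nu (A i).
Proof.
elim: n A => [|n IH] A mA.
  by rewrite big_ord0 /= diracE mem_set// => -[].
rewrite big_ord_recl /= /distribution/= /pushforward box_cons.
rewrite product_measure1E//; last exact: measurable_box.
by congr (_ * _); exact: IH.
Qed.

(** Boxes are stable under intersection and generate the sigma-algebra of
    tuples. *)
Lemma iid_unique n (m : probability (n.-tuple U) R) :
  (forall A, (forall i, measurable (A i)) -> m (box A) = \prod_(i < n) nu (A i)) ->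
  forall B, measurable B -> m B = iid n B.
Proof.
move=> mbox B mB.
pose G := [set B | exists2 A : 'I_n -> set U, (forall i, measurable (A i)) & B = box A].
have GT : G [set: n.-tuple U].
  by exists (fun=> setT) => //; apply/seteqP; split.
apply: (measure_unique G (fun=> setT)) => //.
- apply/seteqP; split.
    apply: smallest_sub; first exact: smallest_sigma_algebra.
    rewrite -bigcup_seq => _ [i _ [C mC <-]].
    apply: sub_sigma_algebra; exists (fun j => if j == i then C else setT).
      by move=> j; case: ifP.
    rewrite setTI; apply/seteqP; split => w /=.
      by move=> Cw j; case: eqP => // ->.
    by move=> /(_ i); rewrite eqxx.
  apply: smallest_sub; first exact: sigma_algebra_measurable.
  by move=> _ [A mA ->]; exact: measurable_box.
- move=> _ _ [A mA ->] [C mC ->]; exists (fun i => A i `&` C i).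
    by move=> i; exact: measurableI.
  apply/seteqP; split => w /=; first by move=> [h1 h2] i; split.
  by move=> h; split => i; case: (h i).
- by rewrite bigcup_const.
- by move=> _ [A mA ->]; exact: etrans (mbox A mA) (esym (iid_box n A mA)).
- move=> _; apply: (@le_lt_trans _ _ 1); last exact: ltry.
  by apply: probability_le1.
Qed.

End iid.

Section law.
Context {d d'} {T : measurableType d} {U : measurableType d'} {R : realType}
  (P : probability T R) (nu : probability U R).

Lemma iid_law n (W : T -> n.-tuple U) : measurable_fun setT W ->
  (forall i A, measurable A -> P ((fun t => tnth (W t) i) @^-1` A) = nu A) ->
  mutually_independent P (fun i t => tnth (W t) i) ->
  forall B, measurable B -> P (W @^-1` B) = iid nu n B.
Proof.
move=> mW Wnu Wind B mB.
pose W' : {mfun T >-> n.-tuple U} := HB.pack W (isMeasurableFun.Build _ _ _ _ _ mW).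
rewrite -[LHS]/(distribution P W' B).
apply: iid_unique => // A mA.
transitivity (P (\bigcap_(i in [set` [set: 'I_n]%SET])
    ((fun t => tnth (W t) i) @^-1` A i))).
  congr (P _); apply/seteqP; split => t /= h i; last by apply: h; rewrite /= inE.
  by move=> _; exact: h.
rewrite Wind//; apply: eq_big => [i|i _]; first by rewrite inE.
exact: Wnu.
Qed.

End law.

(** * Linear forms of a standard Gaussian vector *)

Section linear.
Context {R : realType}.
Local Notation gamma := (@normal_prob R 0 1).
Local Open Scope ereal_scope.

Definition lin {n} (u : 'I_n -> R) (w : n.-tuple R) : R :=
  (\sum_(i < n) u i * tnth w i)%R.

Lemma measurable_lin n (u : 'I_n -> R) : measurable_fun setT (lin u).
Proof.
apply: measurable_sum => i; apply: measurable_funM => //.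
exact: measurable_tnth.
Qed.

Lemma lin_cons n (u : 'I_n.+1 -> R) x w :
  lin u (tuple_cons (x, w)) = (u ord0 * x + lin (fun i => u (lift ord0 i)) w)%R.
Proof.
rewrite /lin big_ord_recl; congr (_ + _)%R.
by apply: eq_bigr => i _; rewrite /tuple_cons tnthS.
Qed.

(** The rotation that carries [p * x + q * y] to a multiple of its first
    variable. *)
Lemma rotation_annihilating (p q : R) :
  exists C S : R, [/\ 0 <= C, C ^+ 2 + S ^+ 2 = 1 & q * C = p * S]%R.
Proof.
have [p0|p0] := eqVneq p 0%R.
  by exists 0%R, 1%R; rewrite p0 mulr0 mul0r expr0n expr1n add0r.
pose t := (q / p)%R.
have t1 : (0 < 1 + t ^+ 2)%R by rewrite ltr_pwDl// sqr_ge0.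
pose C := (Num.sqrt (1 + t ^+ 2))^-1%R.
exists C, (t * C)%R; split.
- by rewrite invr_ge0 sqrtr_ge0.
- transitivity ((1 + t ^+ 2) * C ^+ 2)%R; first by ring.
  by rewrite /C exprVn sqr_sqrtr ?ltW// mulfV ?gt_eqF.
- by rewrite /t mulrA mulrCA divff// mulr1.
Qed.

Lemma integral_probability_cst d (T : measurableType d) (P : probability T R)
  (c : \bar R) : \int[P]_x c = c.
Proof. rewrite -[RHS]mule1 -(probability_setT P); exact: integral_cst. Qed.

Lemma integral_gamma_cst (c : \bar R) : \int[gamma]_x c = c.
Proof. exact: integral_probability_cst. Qed.

(** The triangular form [(a X, b X + c Y)] is a Cholesky factorization of the
    covariance matrix of the two linear forms.  Adding a coordinate [x] to it
    gives a function of three variables [x], [X], [Y]; a rotation of [(x, X)]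
    restores the first component, which leaves the second one depending on three
    variables, and a rotation of the last two restores the triangular form. *)
Lemma lin_law n (u v : 'I_n -> R) :
  exists a b c : R,
    [/\ (a ^+ 2 = \sum_i u i ^+ 2)%R, (a * b = \sum_i u i * v i)%R,
      (b ^+ 2 + c ^+ 2 = \sum_i v i ^+ 2)%R &
      forall f : R * R -> \bar R, measurable_fun setT f -> (forall z, 0 <= f z) ->
        \int[iid gamma n]_w f (lin u w, lin v w) =
        \int[gamma]_x \int[gamma]_y f (a * x, b * x + c * y)%R].
Proof.
elim: n u v => [|n IH] u v.
  exists 0%R, 0%R, 0%R; rewrite !big_ord0 mulr0 expr0n/= addr0; split => // f mf f0.
  rewrite integral_dirac//; last first.
    by apply: measurableT_comp => //; apply: measurable_fun_pair; exact: measurable_lin.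
  rewrite diracE mem_set// mul1e /lin !big_ord0.
  under eq_integral do under eq_integral do rewrite !mul0r addr0.
  by rewrite !integral_gamma_cst.
have [a [b [c [a2 ab bc law]]]] :=
  IH (fun i => u (lift ord0 i)) (fun i => v (lift ord0 i)).
have [C [S [C0 CS aC]]] := rotation_annihilating (u ord0) a.
pose tau := (b * C - v ord0 * S)%R.
have [C' [S' [C'0 CS' cC']]] := rotation_annihilating tau c.
exists (u ord0 * C + a * S)%R, (v ord0 * C + b * S)%R, (tau * C' + c * S')%R.
rewrite !big_ord_recl -a2 -ab -bc; split.
(* Rotations preserve inner products; the subtracted terms are the annihilated
   components. *)
- transitivity ((C ^+ 2 + S ^+ 2) * (u ord0 ^+ 2 + a ^+ 2)
    - (a * C - u ord0 * S) ^+ 2)%R; first by ring.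
  by rewrite CS aC; ring.
- transitivity ((C ^+ 2 + S ^+ 2) * (u ord0 * v ord0 + a * b)
    - (a * C - u ord0 * S) * tau)%R; first by rewrite /tau; ring.
  by rewrite CS aC; ring.
- transitivity ((C ^+ 2 + S ^+ 2) * (v ord0 ^+ 2 + b ^+ 2) - tau ^+ 2
    + ((C' ^+ 2 + S' ^+ 2) * (tau ^+ 2 + c ^+ 2)
       - (c * C' - tau * S') ^+ 2))%R; first by rewrite /tau; ring.
  by rewrite CS CS' cC'; ring.
move=> f mf f0.
rewrite (ge0_integral_iidS gamma n (fun w => f (lin u w, lin v w)))//; last first.
  by apply: measurableT_comp => //; apply: measurable_fun_pair; exact: measurable_lin.
transitivity (\int[gamma]_x \int[gamma]_y \int[gamma]_z
    f (u ord0 * x + a * y, v ord0 * x + (b * y + c * z))%R).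
  apply: eq_integral => x _.
  under eq_integral do rewrite !lin_cons.
  rewrite (law (fun z => f (u ord0 * x + z.1, v ord0 * x + z.2)%R))//.
  by apply: measurableT_comp => //; apply: measurable_fun_pair; exact: measurable_funD.
pose g (p : R * R) : \bar R := \int[gamma]_z
    f (u ord0 * p.1 + a * p.2, v ord0 * p.1 + (b * p.2 + c * z))%R.
have mg : measurable_fun setT g.
  pose F (q : R * R * R) :=
    f (u ord0 * q.1.1 + a * q.1.2, v ord0 * q.1.1 + (b * q.1.2 + c * q.2))%R.
  suff mF : measurable_fun setT F 
    by exact: (@measurable_fun_fubini_tonelli_F _ _ _ _ _ gamma F mF (fun=> f0 _)).
  apply: measurableT_comp => //; apply: measurable_fun_pair.
    by apply: measurable_lin2; apply: measurableT_comp.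
  apply: measurable_funD; first by apply: measurable_funM => //; apply: measurableT_comp.
  by apply: measurable_lin2 => //; apply: measurableT_comp.
have g0 p : 0 <= g p by apply: integral_ge0.
transitivity (\int[gamma]_x \int[gamma]_y g (x, y)); first by [].
rewrite -(normal_rotation C S g mg g0 C0 CS).
apply: eq_integral => x _.
pose a' := (u ord0 * C + a * S)%R; pose b' := (v ord0 * C + b * S)%R.
pose h (p : R * R) := f (a' * x, b' * x + (tau * p.1 + c * p.2))%R.
have mh : measurable_fun setT h.
  apply: measurableT_comp => //; apply: measurable_fun_pair => //.
  by apply: measurable_funD => //; exact: measurable_lin2.
transitivity (\int[gamma]_y \int[gamma]_z h (y, z)).
  apply: eq_integral => y _; apply: eq_integral => z _; rewrite /h/=.
  congr (f (_, _)).
    transitivity (a' * x + (a * C - u ord0 * S) * y)%R; first by rewrite /a'; ring.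
    by rewrite aC subrr mul0r addr0.
  by rewrite /b' /tau; ring.
rewrite -(normal_rotation C' S' h mh (fun=> f0 _) C'0 CS').
apply: eq_integral => y _.
rewrite -[RHS]integral_gamma_cst.
apply: eq_integral => z _; rewrite /h/=; congr (f (_, _)).
transitivity
  (b' * x + ((tau * C' + c * S') * y + (c * C' - tau * S') * z))%R; first by ring.
by rewrite cC' subrr mul0r addr0.
Qed.

End linear.

(** * Anticoncentration of the planar Gaussian on annuli *)

Section annulus.
Context {R : realType}.
Local Notation mu := (@lebesgue_measure R).
Local Notation gamma := (@normal_prob R 0 1).
Local Open Scope ereal_scope.

Lemma normal_prob_le A : measurable A -> gamma A <= (normal_peak 1)%:E * mu A.
Proof.
move=> mA; rewrite -integral_cst// /normal_prob; apply: ge0_le_integral => //.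
- by move=> x _; rewrite lee_fin normal_pdf_ge0.
- by apply/measurable_EFinP/measurable_funTS; exact: measurable_normal_pdf.
- by move=> x _; rewrite lee_fin normal_pdf_ub// oner_neq0.
Qed.

Lemma normal_peak1_sqr : (normal_peak 1 ^+ 2 <= 4^-1 :> R)%R.
Proof.
have h : (4 <= 1 ^+ 2 * pi *+ 2 :> R)%R.
  by have := pi_ge2 R; rewrite expr1n mul1r -mulr_natr; lra.
rewrite /normal_peak exprVn sqr_sqrtr; last by rewrite (le_trans _ h).
by rewrite lef_pV2// posrE ?(lt_le_trans _ h).
Qed.

(** With [p] and [q] the square roots of [l - x ^+ 2] and [b - x ^+ 2], where
    [p = 0] if the first is negative, the slice lies in two intervals of length
    [q - p], and [(q - p) * q <= q ^+ 2 - p ^+ 2 <= b - l].  Dividing by [q] is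
    harmless as long as [q] stays away from [0], which the bound on [x]
    ensures. *)
Lemma lebesgue_slice_annulus (l b x : R) :
  (l <= b)%R -> (0 < b)%R -> (x ^+ 2 <= b / 2)%R ->
  mu [set y | l <= x ^+ 2 + y ^+ 2 <= b]%R <=
    (2 * ((b - l) / Num.sqrt (b / 2)))%:E.
Proof.
move=> lb b0 xb.
pose p := Num.sqrt (l - x ^+ 2)%R; pose q := Num.sqrt (b - x ^+ 2)%R.
have pq : (p <= q)%R by rewrite ler_wsqrtr// lerD2r.
have b2 : (0 < Num.sqrt (b / 2))%R by rewrite sqrtr_gt0 divr_gt0.
have q0 : (Num.sqrt (b / 2) <= q)%R by rewrite ler_wsqrtr//; lra.
have p0 : (0 <= p)%R by exact: sqrtr_ge0.
have qp : (q - p <= (b - l) / Num.sqrt (b / 2))%R.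
  rewrite ler_pdivlMr//.
  have q2 : (q ^+ 2 = b - x ^+ 2)%R by rewrite sqr_sqrtr//; lra.
  have p2 : (l - x ^+ 2 <= p ^+ 2)%R.
    by have [h|h] := leP 0%R (l - x ^+ 2)%R;
      [rewrite sqr_sqrtr|rewrite (le_trans (ltW h))// sqr_ge0].
  apply: (@le_trans _ _ ((q - p) * (q + p))%R).
    by apply: ler_wpM2l; lra.
  by rewrite -subr_sqr q2; lra.
have mI (c d : R) : (c <= d)%R -> mu `[c, d]%classic = (d - c)%:E.
  move=> cd; rewrite lebesgue_measure_itv/= lte_fin.
  case: (ltP c d) => // dc; congr EFin; lra.
apply: (@le_trans _ _ (mu (`[p, q]%classic `|` `[- q, - p]%classic)%R)).
  apply: le_measure; rewrite ?inE.
  - rewrite -[X in measurable X]setTI.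
    rewrite (_ : [set y | _] = (fun y => x ^+ 2 + y ^+ 2)%R @^-1` `[l, b]%classic).
      by apply: measurable_funD => //; exact: measurable_funX.
    by apply/seteqP; split => y /=; rewrite in_itv.
  - exact: measurableU.
  - move=> y /= /andP[ly yb]; rewrite !in_itv/=.
    have py : (p <= `|y|)%R by rewrite -sqrtr_sqr ler_wsqrtr//; lra.
    have yq : (`|y| <= q)%R by rewrite -sqrtr_sqr ler_wsqrtr//; lra.
    have [y0|y0] := leP 0%R y.
      by left; rewrite ger0_norm// in py yq; apply/andP.
    by right; rewrite ltr0_norm// in py yq; apply/andP; split; lra.
apply: (@le_trans _ _ (mu `[p, q]%classic + mu `[- q, - p]%classic)%R).
  exact: measureU2.
by rewrite !mI ?lerN2// -EFinD lee_fin; lra.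
Qed.

(** The slices of the whole annulus at [x] near its outer radius are too long.
    Cutting along the diagonals leaves only slices with [x ^+ 2 <= b / 2]. *)
Definition half_annulus (l b : R) : set (R * R) :=
  [set z | l <= z.1 ^+ 2 + z.2 ^+ 2 <= b /\ z.1 ^+ 2 <= z.2 ^+ 2]%R.

Lemma measurable_half_annulus l b : measurable (half_annulus l b).
Proof.
have m1 : measurable_fun setT (fun z : R * R => z.1 ^+ 2)%R.
  by apply: measurable_funX; exact: measurable_fst.
have m2 : measurable_fun setT (fun z : R * R => z.2 ^+ 2)%R.
  by apply: measurable_funX; exact: measurable_snd.
rewrite (_ : half_annulus l b =
  (setT `&` (fun z => z.1 ^+ 2 + z.2 ^+ 2)%R @^-1` `[l, b]%classic) `&`
  (setT `&` (fun z => z.2 ^+ 2 - z.1 ^+ 2)%R @^-1` `[0%R, +oo[%classic)).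
  apply: measurableI; first exact: measurable_funD.
  exact: measurable_funB.
apply/seteqP; split => z /=; rewrite !in_itv/= ?andbT subr_ge0.
  by move=> [? ?].
by move=> [[_ ?] [_ ?]].
Qed.

(** Slices have length [O(h / sqrt b)] and there is a range of [O(sqrt b)] of
    them, so the radius cancels and the area is [O(h)]. *)
Lemma normal_half_annulus (l h : R) : (0 <= l)%R -> (0 < h)%R ->
  (gamma \x gamma) (half_annulus l (l + h)) <= h%:E.
Proof.
move=> l0 h0; set b := (l + h)%R.
have b0 : (0 < b)%R by rewrite /b ltr_wpDl.
pose r := Num.sqrt (b / 2)%R.
have r0 : (0 < r)%R by rewrite sqrtr_gt0 divr_gt0.
pose K := (normal_peak 1 * (2 * (h / r)))%R.
have K0 : (0 <= K)%R by rewrite mulr_ge0 ?normal_peak_ge0// mulr_ge0// divr_ge0// ltW.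
have slice x : gamma (xsection (half_annulus l b) x) <=
    K%:E * (\1_(`[- r, r]%classic) x)%:E.
  have mxs : measurable (xsection (half_annulus l b) x).
    by apply: measurable_xsection; exact: measurable_half_annulus.
  rewrite indicE; have [xr|xr] := boolP (x \in _).
    rewrite mule1; apply: (le_trans (normal_prob_le _ mxs)).
    rewrite /K EFinM lee_wpmul2l ?lee_fin ?normal_peak_ge0//.
    have xb : (x ^+ 2 <= b / 2)%R.
      have r2 : (r ^+ 2 = b / 2)%R by rewrite sqr_sqrtr// divr_ge0// ltW.
      by move: xr; rewrite inE/= in_itv/= -r2 => /andP[? ?]; nra.
    have lb : (l <= b)%R by rewrite /b; lra.
    have -> : h = (b - l)%R by rewrite /b; lra.
    apply: le_trans (lebesgue_slice_annulus l b x lb b0 xb).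
    apply: le_measure; rewrite ?inE//.
      rewrite -[X in measurable X]setTI.
      rewrite (_ : [set y | _] = (fun y => x ^+ 2 + y ^+ 2)%R @^-1` `[l, b]%classic).
        by apply: measurable_funD => //; exact: measurable_funX.
      by apply/seteqP; split => y /=; rewrite in_itv.
    by move=> y; rewrite -in_setE mem_xsection inE => -[].
  rewrite mule0 (_ : xsection _ _ = set0) ?measure0//.
  apply/seteqP; split => // y; rewrite -in_setE mem_xsection inE => -[/= /andP[_ xyb] xy].
  move: xr; rewrite notin_setE; apply; rewrite /= in_itv/= -ler_norml.
  rewrite -[leLHS]sqrtr_sqr ler_wsqrtr//; lra.
rewrite -[_ (half_annulus _ _)]/(\int[gamma]_x gamma (xsection _ x)).
apply: (@le_trans _ _ (\int[gamma]_x (K%:E * (\1_(`[- r, r]%classic) x)%:E))).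
  apply: ge0_le_integral => //.
  - by apply: (measurable_fun_xsection gamma); exact: measurable_half_annulus.
  - apply: emeasurable_funM => //; exact/measurable_EFinP.
rewrite ge0_integralZl//; last exact/measurable_EFinP.
rewrite integral_indic// setIT.
have gr : gamma `[(- r)%R, r]%classic <= (normal_peak 1 * (2 * r))%:E.
  apply: (le_trans (normal_prob_le _ _)) => //.
  rewrite lebesgue_measure_itv/= lte_fin ifT ?gtrN// -EFinD -EFinM lee_fin.
  by rewrite opprK mulr2n mulrDl mul1r.
apply: (@le_trans _ _ (K%:E * (normal_peak 1 * (2 * r))%:E)).
  by rewrite lee_wpmul2l// lee_fin.
rewrite -EFinM lee_fin /K.
apply: (@le_trans _ _ (4 * h * normal_peak 1 ^+ 2)%R).
  rewrite le_eqVlt; apply/orP; left; apply/eqP.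
  by rewrite expr2; field; rewrite gt_eqF.
have := normal_peak1_sqr; have := ltW h0; nra.
Qed.

(** The annulus is covered by a half annulus and its mirror image in the diagonal.
    A negative lower bound [l] may be raised to [0]. *)
Lemma normal_annulus (l h : R) : (0 < h)%R ->
  (gamma \x gamma) [set z | l <= z.1 ^+ 2 + z.2 ^+ 2 <= l + h]%R <= (2 * h)%:E.
Proof.
move=> h0; pose l' := Num.max l 0%R.
have l'0 : (0 <= l')%R by rewrite le_max lexx orbT.
have ll' : (l <= l')%R by rewrite le_max lexx.
pose A := half_annulus l' (l' + h).
pose B := (fun z : R * R => (z.2, z.1)) @^-1` A.
have mA : measurable A by exact: measurable_half_annulus.
have mB : measurable B.
  rewrite -[X in measurable X]setTI.
  by have := measurable_fun_pair measurable_snd measurable_fst; apply.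
have -> : (2 * h)%:E = h%:E + h%:E by rewrite -EFinD; congr EFin; ring.
apply: (@le_trans _ _ ((gamma \x gamma) (A `|` B))).
  apply: le_measure; rewrite ?inE//.
  - rewrite -[X in measurable X]setTI.
    rewrite (_ : [set z | _] =
      (fun z : R * R => z.1 ^+ 2 + z.2 ^+ 2)%R @^-1` `[l, (l + h)%R]%classic).
      by apply: measurable_funD => //; apply: measurable_funX.
    by apply/seteqP; split => y /=; rewrite in_itv.
  - exact: measurableU.
  - move=> [x y] /= /andP[lz zl].
    have h1 : (l' <= x ^+ 2 + y ^+ 2)%R by rewrite ge_max lz addr_ge0// sqr_ge0.
    have h2 : (x ^+ 2 + y ^+ 2 <= l' + h)%R by lra.
    have [xy|xy] := leP (x ^+ 2)%R (y ^+ 2)%R.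
      by left; split => //=; rewrite h1.
    by right; split => /=; [rewrite addrC h1|exact: ltW].
apply: (@le_trans _ _ ((gamma \x gamma) A + (gamma \x gamma) B)).
  exact: measureU2.
apply: leeD; first exact: normal_half_annulus.
rewrite (product_measure_unique (m' := (gamma \x^ gamma))) //; last first.
  by move=> ? ? ? ?; exact: product_measure2E.
apply: le_trans (normal_half_annulus l' h l'0 h0).
rewrite le_eqVlt; apply/orP; left; apply/eqP.
by apply: eq_integral.
Qed.

End annulus.

(** * Sums and products over an independent family *)

Section iid_sum.
Context {d} {U : measurableType d} {R : realType} (nu : probability U R).
Local Open Scope ereal_scope.

Lemma measurable_sum_iid n (q : U -> R) : measurable_fun setT q ->
  measurable_fun setT (fun w : n.-tuple U => \sum_(i < n) q (tnth w i))%R.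
Proof.
move=> mq; apply: measurable_sum => i; apply: measurableT_comp => //.
exact: measurable_tnth.
Qed.

(** The bound is obtained conditionally on all variables but two; [c] stands for
    the sum over the frozen ones. *)
Lemma iid_sum_le n (q : U -> R) (J : set R) (B : R) :
  measurable_fun setT q -> measurable J ->
  (forall c, \int[nu]_x \int[nu]_y (\1_J (q x + (q y + c))%R)%:E <= B%:E) ->
  iid nu n.+2 [set w | J (\sum_(i < n.+2) q (tnth w i))%R] <= B%:E.
Proof.
move=> mq mJ hB.
set A := (X in iid _ _ X).
have mA : measurable A.
  by rewrite -[A]setTI; exact: (measurable_sum_iid n.+2 q mq).
have mI : measurable_fun setT (fun r : R => (\1_J r : R)%:E).
  exact/measurable_EFinP.
have I0 (r : R) : 0 <= (\1_J r : R)%:E by rewrite lee_fin.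
pose S (w : n.-tuple U) : R := (\sum_(i < n) q (tnth w i))%R.
have mS : measurable_fun setT S by exact: measurable_sum_iid.
pose f (z : U * U * n.-tuple U) : \bar R := (\1_J (q z.1.1 + (q z.1.2 + S z.2)) : R)%:E.
have mh : measurable_fun setT
    (fun z : U * U * n.-tuple U => q z.1.1 + (q z.1.2 + S z.2))%R.
  apply: measurable_funD.
    by apply: measurableT_comp => //; apply: measurableT_comp.
  apply: measurable_funD; last exact: measurableT_comp.
  by apply: measurableT_comp => //; apply: measurableT_comp.
have mf : measurable_fun setT f by exact: measurableT_comp mI mh.
have -> : iid nu n.+2 A = \int[nu]_x \int[nu]_y \int[iid nu n]_w f (x, y, w).
  rewrite -[A in LHS]setIT -integral_indic//.
  have mAf : measurable_fun setT (fun w => (\1_A w : R)%:E) by exact/measurable_EFinP.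
  have Ax0 k (F : k.-tuple U -> n.+2.-tuple U) w : 0 <= (\1_A (F w) : R)%:E.
    by rewrite lee_fin.
  rewrite (ge0_integral_iidS nu n.+1 _ mAf (Ax0 _ id)); apply: eq_integral => x _.
  have mAx := measurableT_comp mAf
    (measurableT_comp (measurable_tuple_cons n.+1) (pair1_measurable x)).
  rewrite (ge0_integral_iidS nu n _ mAx (Ax0 _ (fun w => tuple_cons (x, w)))).
  apply: eq_integral => y _; apply: eq_integral => w _.
  rewrite /f/=; congr EFin.
  rewrite !indicE; congr (_ : bool)%:R; apply/idP/idP; rewrite !inE /A/= !big_ord_recl/=.
    by under eq_bigr do rewrite /tuple_cons !tnthS.
  by under [in X in _ -> X]eq_bigr do rewrite /tuple_cons !tnthS.
pose g (z : U * n.-tuple U) : \bar R := \int[nu]_y f (z.1, y, z.2).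
have mg : measurable_fun setT g.
  pose f' (z : U * n.-tuple U * U) := f (z.1.1, z.2, z.1.2).
  suff mf' : measurable_fun setT f' by
    exact: (@measurable_fun_fubini_tonelli_F _ _ _ _ _ nu f' mf' (fun=> I0 _)).
  apply: measurableT_comp => //; apply: measurable_fun_pair => /=.
    by apply: measurable_fun_pair => //; apply: measurableT_comp.
  exact: measurableT_comp.
have f0 z : 0 <= f z by exact: I0.
have g0 z : 0 <= g z by apply: integral_ge0.
have -> : \int[nu]_x \int[nu]_y \int[iid nu n]_w f (x, y, w) =
    \int[iid nu n]_w \int[nu]_x g (x, w).
  transitivity (\int[nu]_x \int[iid nu n]_w g (x, w)); last first.
    exact: (@fubini_tonelli _ _ _ _ _ nu (iid nu n) g mg g0).
  apply: eq_integral => x _.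
  pose fx (z : U * n.-tuple U) := f (x, z.1, z.2).
  have mfx : measurable_fun setT fx.
    apply: (measurableT_comp mf); apply: measurable_fun_pair => //.
    exact: measurable_fun_pair.
  exact: (@fubini_tonelli _ _ _ _ _ nu (iid nu n) fx mfx (fun=> f0 _)).
rewrite -[leRHS](integral_probability_cst _ _ (iid nu n)).
apply: ge0_le_integral => //.
- by move=> w _; apply: integral_ge0.
- exact: (@measurable_fun_fubini_tonelli_G _ _ _ _ _ nu g mg g0).
- by move=> w _; exact: (hB (S w)).
Qed.

Lemma iid_integral_prod n (h : U -> R) (m : R) :
  measurable_fun setT h -> (forall x, 0 <= h x)%R ->
  \int[nu]_x (h x)%:E = m%:E ->
  \int[iid nu n]_w (\prod_(i < n) h (tnth w i))%:E = (m ^+ n)%:E.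
Proof.
move=> mh h0 hm.
have mprod k : measurable_fun setT
    (fun w : k.-tuple U => (\prod_(i < k) h (tnth w i))%:E).
  apply/measurable_EFinP; apply: measurable_prod => i _.
  by apply: measurableT_comp => //; exact: measurable_tnth.
have prod0 k (w : k.-tuple U) : 0 <= (\prod_(i < k) h (tnth w i))%:E.
  by rewrite lee_fin prodr_ge0.
elim: n => [|n IH].
  rewrite expr0; under eq_integral do rewrite big_ord0.
  exact: integral_probability_cst.
rewrite ge0_integral_iidS//.
transitivity (\int[nu]_x ((m ^+ n)%:E * (h x)%:E)).
  apply: eq_integral => x _; rewrite -IH.
  rewrite -(ge0_integralZr (iid nu n) measurableT (mprod n)
    (fun w _ => prod0 n w)); last by rewrite lee_fin.
  apply: eq_integral => w _; rewrite big_ord_recl EFinM muleC; congr (_%:E * _).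
  by apply: eq_bigr => i _; rewrite /tuple_cons tnthS.
have m0 : (0 <= m)%R.
  by rewrite -lee_fin -hm; apply: integral_ge0 => x _; rewrite lee_fin.
rewrite ge0_integralZl//.
- by rewrite hm -EFinM exprSr.
- exact/measurable_EFinP.
- by move=> x _; rewrite lee_fin.
- by rewrite lee_fin exprn_ge0.
Qed.

End iid_sum.

(** * Anticoncentration of the quadratic form *)

Section quadratic.
Context {R : realType}.
Local Notation gamma := (@normal_prob R 0 1).
Local Open Scope ereal_scope.

(** The lemma on sums also matches differences, leaving an opposite to treat, so
    differences are tried first. *)
Ltac measurable_polynomial := repeat first
  [ exact: measurable_fst | exact: measurable_snd | exact: measurable_cst
  | exact: measurable_id
  | apply: measurable_funB | apply: measurable_funD | apply: measurable_funX
  | apply: measurable_funM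
  | apply: (measurableT_comp measurable_fst) | apply: (measurableT_comp measurable_snd) ].

Lemma normal_swap (f : R * R -> \bar R) :
  measurable_fun setT f -> (forall z, 0 <= f z) ->
  \int[gamma]_x \int[gamma]_y f (x, y) = \int[gamma]_y \int[gamma]_x f (x, y).
Proof. by move=> mf f0; exact: (@fubini_tonelli _ _ _ _ _ gamma gamma f mf f0). Qed.

Lemma measurable_normal_integral d (T : measurableType d) (f : T * R -> \bar R) :
  measurable_fun setT f -> (forall z, 0 <= f z) ->
  measurable_fun setT (fun t => \int[gamma]_x f (t, x)).
Proof.
by move=> mf f0; exact: (@measurable_fun_fubini_tonelli_F _ _ _ _ _ gamma f mf f0).
Qed.

Lemma normal_anticoncentration (a c e : R) : (0 < e)%R -> (2 <= a ^+ 2)%R ->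
  \int[gamma]_x \int[gamma]_y
    (\1_`[(- e)%R, e]%classic (a ^+ 2 * (x ^+ 2 + y ^+ 2) + c)%R)%:E <= (2 * e)%:E.
Proof.
move=> e0 a2.
have a0 : (0 < a ^+ 2)%R by lra.
pose S := [set z : R * R | ((- e - c) / a ^+ 2 <= z.1 ^+ 2 + z.2 ^+ 2 <=
  (- e - c) / a ^+ 2 + 2 * e / a ^+ 2)%R].
have mS : measurable S.
  rewrite -[S]setTI.
  rewrite (_ : S = (fun z : R * R => z.1 ^+ 2 + z.2 ^+ 2)%R @^-1`
    `[((- e - c) / a ^+ 2)%R, ((- e - c) / a ^+ 2 + 2 * e / a ^+ 2)%R]%classic).
    by suff : measurable_fun setT (fun z : R * R => z.1 ^+ 2 + z.2 ^+ 2)%R;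
      [apply|measurable_polynomial].
  by apply/seteqP; split => y /=; rewrite in_itv.
apply: (@le_trans _ _ ((gamma \x gamma) S)); last first.
  apply: (le_trans (normal_annulus _ _ _)); first by rewrite divr_gt0// mulr_gt0.
  by rewrite lee_fin ler_pM2l// ler_pdivrMr//; nra.
rewrite -[S in leRHS]setIT -integral_indic//.
have m1 : measurable_fun setT (fun z => (\1_S z : R)%:E) by exact/measurable_EFinP.
rewrite (@fubini_tonelli1 _ _ _ _ _ gamma gamma _ m1); last by move=> z; rewrite lee_fin.
rewrite le_eqVlt; apply/orP; left; apply/eqP.
apply: eq_integral => x _; apply: eq_integral => y _; congr EFin.
rewrite !indicE; congr (_ : bool)%:R; apply/idP/idP; rewrite !inE /S/= in_itv/=.
  move=> /andP[h1 h2]; apply/andP; split.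
    by rewrite ler_pdivrMr//; lra.
  by rewrite -mulrDl ler_pdivlMr//; lra.
rewrite -mulrDl ler_pdivrMr// ler_pdivlMr// => /andP[h1 h2]; apply/andP; split; lra.
Qed.

Definition quad {n} (u v : 'I_n -> R) (w : n.-tuple R) : R :=
  (lin u w ^+ 2 - lin v w ^+ 2)%R.

Lemma measurable_quad n (u v : 'I_n -> R) : measurable_fun setT (quad u v).
Proof.
by apply: measurable_funB; apply: measurable_funX; exact: measurable_lin.
Qed.

(** Orthogonality of [u] and [v] makes the triangular form of [lin_law] diagonal
    ([b = 0]).  With [x1], [x2] the [u]-coordinates and [y1], [y2] the
    [v]-coordinates of the two vectors, the estimate holds for the integral over
    [x1] and [x2] alone, whatever [y1] and [y2] are. *)
Lemma quad_anticoncentration n (u v : 'I_n -> R) (e c : R) : (0 < e)%R ->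
  (\sum_i u i * v i = 0)%R -> (2 <= \sum_i u i ^+ 2)%R ->
  \int[iid gamma n]_x \int[iid gamma n]_y
    (\1_`[(- e)%R, e]%classic (quad u v x + (quad u v y + c))%R)%:E <= (2 * e)%:E.
Proof.
move=> e0 uv0 u2.
have [a [b [k [a2 ab bk law]]]] := lin_law n u v.
have b0 : b = 0%R.
  move: ab; rewrite uv0 => /eqP; rewrite mulf_eq0 => /orP[/eqP a0|/eqP//].
  by move: u2; rewrite -a2 a0 expr0n/=; lra.
have {}law (f : R * R -> \bar R) : measurable_fun setT f -> (forall z, 0 <= f z) ->
    \int[iid gamma n]_w f (lin u w, lin v w) =
    \int[gamma]_x \int[gamma]_y f (a * x, k * y)%R.
  move=> mf f0; rewrite (law f mf f0).
  apply: eq_integral => x _; apply: eq_integral => y _.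
  by rewrite b0 mul0r add0r.
pose I (t : R) : \bar R := (\1_`[(- e)%R, e]%classic t : R)%:E.
have mI : measurable_fun setT I by exact/measurable_EFinP.
have I0 t : 0 <= I t by rewrite lee_fin.
have mIc d (T : measurableType d) (f : T -> R) : measurable_fun setT f ->
  measurable_fun setT (I \o f) by exact: measurableT_comp.
pose F (x1 y1 x2 y2 : R) : \bar R :=
  I ((a * x1) ^+ 2 - (k * y1) ^+ 2 + ((a * x2) ^+ 2 - (k * y2) ^+ 2 + c))%R.
pose G (t : R) : \bar R := \int[iid gamma n]_y I (t + (quad u v y + c))%R.
pose H (t : R) : \bar R :=
  \int[gamma]_y \int[gamma]_x I (t + ((a * x) ^+ 2 - (k * y) ^+ 2 + c))%R.
have GH t : G t = H t.
  pose f (z : R * R) := I (t + (z.1 ^+ 2 - z.2 ^+ 2 + c))%R.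
  have mf : measurable_fun setT f.
    apply: (mIc _ _ (fun z : R * R =>
      t + (z.1 ^+ 2 - z.2 ^+ 2 + c))%R).
    by measurable_polynomial.
  rewrite [LHS](law f mf (fun=> I0 _)).
  pose f' (z : R * R) := f (a * z.1, k * z.2)%R.
  have mf' : measurable_fun setT f'.
    apply: (mIc _ _ (fun z : R * R =>
      t + ((a * z.1) ^+ 2 - (k * z.2) ^+ 2 + c))%R).
    by measurable_polynomial.
  exact: (normal_swap f' mf' (fun=> I0 _)).
have mH : measurable_fun setT H.
  pose f (z : R * R * R) := I (z.1.1 + ((a * z.2) ^+ 2 - (k * z.1.2) ^+ 2 + c))%R.
  have mf : measurable_fun setT f.
    apply: (mIc _ _ (fun z : R * R * R =>
      z.1.1 + ((a * z.2) ^+ 2 - (k * z.1.2) ^+ 2 + c))%R).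
    by measurable_polynomial.
  have mf1 := measurable_normal_integral _ _ f mf (fun=> I0 _).
  apply: (measurable_normal_integral _ _ _ mf1) => z.
  by apply: integral_ge0 => *; exact: I0.
have H0 t : 0 <= H t.
  by apply: integral_ge0 => y _; apply: integral_ge0 => x _; exact: I0.
pose h (z : R * R) := H (z.1 ^+ 2 - z.2 ^+ 2)%R.
have mh : measurable_fun setT h.
  apply: (@measurableT_comp _ _ _ _ _ _ H _
    (fun z : R * R => z.1 ^+ 2 - z.2 ^+ 2)%R mH).
  by measurable_polynomial.
pose h' (z : R * R) := H ((a * z.1) ^+ 2 - (k * z.2) ^+ 2)%R.
have mh' : measurable_fun setT h'.
  apply: (@measurableT_comp _ _ _ _ _ _ H _
    (fun z : R * R => (a * z.1) ^+ 2 - (k * z.2) ^+ 2)%R mH).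
  by measurable_polynomial.
have -> : \int[iid gamma n]_x \int[iid gamma n]_y I (quad u v x + (quad u v y + c))%R
    = \int[gamma]_y1 \int[gamma]_x1 \int[gamma]_y2 \int[gamma]_x2 F x1 y1 x2 y2.
  transitivity (\int[iid gamma n]_x h (lin u x, lin v x)).
    by apply: eq_integral => x _; exact: GH.
  rewrite (law h mh (fun=> H0 _)).
  exact: (normal_swap h' mh' (fun=> H0 _)).
have step y1 : \int[gamma]_x1 \int[gamma]_y2 \int[gamma]_x2 F x1 y1 x2 y2 <= (2 * e)%:E.
  pose f (z : R * R * R) := F z.1.1 y1 z.2 z.1.2.
  have mf : measurable_fun setT f.
    apply: (mIc _ _ (fun z : R * R * R =>
      (a * z.1.1) ^+ 2 - (k * y1) ^+ 2 + ((a * z.2) ^+ 2 - (k * z.1.2) ^+ 2 + c))%R).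
    by measurable_polynomial.
  pose g (z : R * R) : \bar R := \int[gamma]_x2 F z.1 y1 x2 z.2.
  have mg : measurable_fun setT g.
    exact: (measurable_normal_integral _ _ f mf (fun=> I0 _)).
  have g0 z : 0 <= g z by apply: integral_ge0 => *; exact: I0.
  rewrite [leLHS](normal_swap g mg g0) -[leRHS]integral_gamma_cst.
  apply: ge0_le_integral.
  - exact: measurableT.
  - by move=> y2 _; apply: integral_ge0 => x1 _; exact: g0.
  - exact: (@measurable_fun_fubini_tonelli_G _ _ _ _ _ gamma g mg g0).
  - exact: measurable_cst.
  - move=> y2 _.
    have u2a : (2 <= a ^+ 2)%R by rewrite a2.
    apply: le_trans (normal_anticoncentration a
      (c - (k * y1) ^+ 2 - (k * y2) ^+ 2) e e0 u2a).
    rewrite le_eqVlt; apply/orP; left; apply/eqP.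
    apply: eq_integral => x1 _; apply: eq_integral => x2 _; apply: (congr1 I) => /=; ring.
rewrite -[leRHS]integral_gamma_cst; apply: ge0_le_integral.
- exact: measurableT.
- by move=> y1 _; apply: integral_ge0 => x1 _; exact: H0.
- exact: (@measurable_fun_fubini_tonelli_G _ _ _ _ _ gamma h' mh' (fun=> H0 _)).
- exact: measurable_cst.
- by move=> y1 _; exact: step.
Qed.

End quadratic.

(** * The Chernoff bound for the squared norm *)

Section chernoff.
Context {R : realType}.
Local Notation mu := (@lebesgue_measure R).
Local Notation gamma := (@normal_prob R 0 1).
Local Open Scope ereal_scope.

(** The exponent turns the density of [N(0, 1)] into [sqrt delta] times that of
    [N(0, delta)]. *)
Lemma normal_laplace (delta : R) : (0 < delta)%R ->
  \int[gamma]_x (expR (- ((delta^-1 - 1) / 2 * x ^+ 2)))%:E = (Num.sqrt delta)%:E.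
Proof.
move=> d0; rewrite ge0_integral_normal_prob; last 2 first.
- by apply/measurable_EFinP; apply: measurableT_comp => //; apply: measurableT_comp => //;
  apply: measurable_funM => //; exact: measurable_funX.
- by move=> x; rewrite lee_fin expR_ge0.
have s0 : (Num.sqrt delta != 0)%R by rewrite gt_eqF// sqrtr_gt0.
transitivity (\int[mu]_x ((Num.sqrt delta)%:E * (normal_pdf 0 (Num.sqrt delta) x)%:E)).
  apply: eq_integral => x _; rewrite -!EFinM; congr EFin.
  rewrite !normal_pdfE ?oner_neq0// /normal_fun subr0 mulrCA -expRD [RHS]mulrA.
  congr (_ * expR _)%R.
    rewrite /normal_peak sqr_sqrtr ?ltW// expr1n mul1r -mulrnAr.
    by rewrite [in RHS]sqrtrM ?ltW// invfM mulrA divff// mul1r.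
  by rewrite sqr_sqrtr ?ltW//; field; rewrite gt_eqF.
rewrite ge0_integralZl//.
- by rewrite integral_normal_pdf mule1.
- by apply/measurable_EFinP; exact: measurable_normal_pdf.
- by move=> x _; rewrite lee_fin normal_pdf_ge0.
Qed.

(** A unit linear form is a standard normal variable up to sign: in [lin_law],
    taken with [v = 0], the coefficient [a] satisfies [a ^+ 2 = 1]. *)
Lemma lin_laplace n (x : 'I_n -> R) (delta : R) : (0 < delta)%R ->
  (\sum_i x i ^+ 2 = 1)%R ->
  \int[iid gamma n]_w (expR (- ((delta^-1 - 1) / 2 * lin x w ^+ 2)))%:E =
  (Num.sqrt delta)%:E.
Proof.
move=> d0 x1; have [a [b [k [a2 _ _ law]]]] := lin_law n x (fun=> 0%R).
pose f (z : R * R) : \bar R := (expR (- ((delta^-1 - 1) / 2 * z.1 ^+ 2)))%:E.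
have mf : measurable_fun setT f.
  apply/measurable_EFinP; apply: measurableT_comp => //; apply: measurableT_comp => //.
  by apply: measurable_funM => //; apply: measurable_funX; exact: measurable_fst.
have f0 z : 0 <= f z by rewrite lee_fin expR_ge0.
rewrite [LHS](law f mf f0) -normal_laplace//.
apply: eq_integral => z _; rewrite -[RHS]integral_gamma_cst.
by apply: eq_integral => y _; rewrite /f/= exprMn a2 x1 mul1r.
Qed.

(** Exponential Markov inequality with the parameter [l] that minimizes
    [expR (l * delta) / Num.sqrt (1 + 2 * l)], namely [1 + 2 * l = delta^-1]. *)
Lemma lin_chernoff n s (x : 'I_n -> R) (delta : R) : (0 < delta)%R -> (delta <= 1)%R ->
  (\sum_i x i ^+ 2 = 1)%R ->
  iid (iid gamma n) s
    [set w | (\sum_(i < s) lin x (tnth w i) ^+ 2 <= s%:R * delta)%R] <=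
  ((delta * expR (1 - delta)) `^ (s%:R / 2))%:E.
Proof.
move=> d0 d1 x1.
pose l := ((delta^-1 - 1) / 2)%R.
have l0 : (0 <= l)%R by rewrite divr_ge0// subr_ge0 invf_ge1.
pose h (w : n.-tuple R) := expR (- (l * lin x w ^+ 2)).
have msq : measurable_fun setT (fun w : n.-tuple R => lin x w ^+ 2)%R.
  by apply: measurable_funX; exact: measurable_lin.
have mh : measurable_fun setT h.
  apply: measurableT_comp => //; apply: measurableT_comp => //.
  exact: measurable_funM.
set A := (X in iid _ _ X).
have mA : measurable A.
  rewrite -[A]setTI.
  rewrite (_ : A = (fun w : s.-tuple (n.-tuple R) =>
    \sum_(i < s) lin x (tnth w i) ^+ 2)%R @^-1` `]-oo, (s%:R * delta)%R]%classic).
    exact: (measurable_sum_iid s _ msq).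
  by apply/seteqP; split => w /=; rewrite in_itv.
have mprod : measurable_fun setT
    (fun w : s.-tuple (n.-tuple R) => (\prod_(i < s) h (tnth w i))%:E).
  apply/measurable_EFinP; apply: measurable_prod => i _.
  by apply: measurableT_comp => //; exact: measurable_tnth.
have prod0 (w : s.-tuple (n.-tuple R)) : 0 <= (\prod_(i < s) h (tnth w i))%:E.
  by rewrite lee_fin prodr_ge0// => i _; exact: expR_ge0.
rewrite -[A]setIT -integral_indic//.
apply: (@le_trans _ _ (\int[iid (iid gamma n) s]_w
    ((expR (l * (s%:R * delta)))%:E * (\prod_(i < s) h (tnth w i))%:E))).
  apply: ge0_le_integral.
  - exact: measurableT.
  - by move=> w _; rewrite lee_fin.
  - by apply/measurable_EFinP; exact: measurable_indic.
  - by apply: emeasurable_funM => //; exact: measurable_cst.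
  move=> w _; rewrite -EFinM lee_fin -expR_sum -expRD indicE.
  have [wA|_] := boolP (w \in A); last exact: expR_ge0.
  rewrite -[leLHS]expR0 ler_expR sumrN -mulr_sumr -mulrBr mulr_ge0// subr_ge0.
  by move: wA; rewrite inE.
have k0 : 0 <= (expR (l * (s%:R * delta)))%:E by rewrite lee_fin expR_ge0.
rewrite [leLHS](ge0_integralZl (iid (iid gamma n) s) measurableT mprod
  (fun w _ => prod0 w) k0).
rewrite [X in _ * X](iid_integral_prod (iid gamma n) s h (Num.sqrt delta) mh
  (fun w => expR_ge0 _) (lin_laplace _ x delta d0 x1)).
rewrite -EFinM lee_fin le_eqVlt; apply/orP; left; apply/eqP.
rewrite powRM ?expR_ge0 ?ltW// mulrC; congr (_ * _)%R.
  by rewrite -powR12_sqrt ?ltW// -powR_mulrn ?powR_ge0// -powRrM mulrC.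
by rewrite -expRM /l; congr expR; field; rewrite gt_eqF.
Qed.

End chernoff.

(** * The sketched inner product *)

Section polarization.
Context {R : realType}.

Lemma innerE n (u v : 'cV[R]_n) : inner u v = \sum_(j < n) u j ord0 * v j ord0.
Proof. by rewrite /inner mxE; apply: eq_bigr => j _; rewrite mxE. Qed.

Lemma enorm1_sqr n (x : 'cV[R]_n) : enorm x = 1 -> \sum_(j < n) x j ord0 ^+ 2 = 1.
Proof.
move=> x1; rewrite -[RHS](expr1n _ 2) -x1 /enorm sqr_sqrtr innerE.
  by apply: eq_bigr => j _; rewrite expr2.
by apply: sumr_ge0 => j _; rewrite -expr2 sqr_ge0.
Qed.

Lemma linD n (u v : 'I_n -> R) w : lin (fun j => u j + v j) w = lin u w + lin v w.
Proof. by rewrite /lin -big_split; apply: eq_bigr => j _; rewrite mulrDl. Qed.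

Lemma linB n (u v : 'I_n -> R) w : lin (fun j => u j - v j) w = lin u w - lin v w.
Proof. by rewrite /lin -sumrB; apply: eq_bigr => j _; rewrite mulrBl. Qed.

(** [u] and [v] are [x + y] and [x - y] in an order that makes [u] the longer one;
    the lower bound on its length is the average of the two squared lengths. *)
Lemma quad_polarization n (x y : 'I_n -> R) :
  \sum_j x j ^+ 2 = 1 -> \sum_j y j ^+ 2 = 1 ->
  exists u v : 'I_n -> R,
    [/\ \sum_j u j * v j = 0, 2 <= \sum_j u j ^+ 2 &
     forall s (w : s.-tuple (n.-tuple R)), `|\sum_(i < s) quad u v (tnth w i)| =
       4 * `|\sum_(i < s) (lin x (tnth w i) * lin y (tnth w i))| ].
Proof.
move=> x1 y1.
pose p j := x j + y j; pose q j := x j - y j.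
have pq0 : \sum_j p j * q j = 0.
  transitivity (\sum_j (x j ^+ 2 - y j ^+ 2)).
    by apply: eq_bigr => j _; rewrite /p /q; ring.
  by rewrite sumrB x1 y1 subrr.
have pq4 : \sum_j p j ^+ 2 + \sum_j q j ^+ 2 = 4.
  rewrite -big_split; transitivity (\sum_j (2 * x j ^+ 2 + 2 * y j ^+ 2)).
    by apply: eq_bigr => j _; rewrite /p /q /=; ring.
  by rewrite big_split/= -!mulr_sumr x1 y1; ring.
have quadE w : quad p q w = 4 * (lin x w * lin y w).
  by rewrite /quad linD linB; ring.
have quadN w : quad q p w = - (4 * (lin x w * lin y w)).
  by rewrite -quadE /quad opprB.
have [p2|p2] := leP 2 (\sum_j p j ^+ 2).
  exists p, q; split => // s w.
  under eq_bigr do rewrite quadE.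
  by rewrite -mulr_sumr normrM ger0_norm.
exists q, p; split.
- by rewrite -[RHS]pq0; apply: eq_bigr => j _; rewrite mulrC.
- by lra.
- move=> s w; under eq_bigr do rewrite quadN.
  by rewrite sumrN normrN -mulr_sumr normrM ger0_norm.
Qed.

End polarization.

Section sketch.
Context {d : measure_display} {T : measurableType d} {R : realType}
  (P : probability T R).

Lemma sketch_law s n (Omega : T -> 'M[R]_(s, n)) :
  gaussian_sketching_matrix P Omega ->
  exists W : T -> s.-tuple (n.-tuple R),
    (forall B, measurable B ->
      P (W @^-1` B) = iid (iid (normal_prob 0 1) n) s B) /\
    forall t (x y : 'cV[R]_n), inner (Omega t *m x) (Omega t *m y) =
      s%:R^-1 * \sum_(i < s)
        (lin (fun j => x j ord0) (tnth (W t) i)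
         * lin (fun j => y j ord0) (tnth (W t) i)).
Proof.
move=> [omega [og oind OmE]].
pose W t := [tuple omega i t | i < s].
have mW : measurable_fun setT W.
  apply/measurable_fun_tnthP => i; rewrite (_ : _ \o _ = omega i)//.
  by apply/funext => t /=; rewrite tnth_mktuple.
exists W; split.
  apply: (iid_law P (iid (normal_prob 0 1) n) s W mW).
    move=> i A mA; rewrite (_ : (fun t => _) = omega i).
      have [om oi] := og i.
      have mo : measurable_fun setT (omega i) by exact: measurable_funPT.
      exact: (iid_law P (normal_prob 0 1) n (omega i) mo om oi).
    by apply/funext => t; rewrite /= /W tnth_mktuple.
  rewrite (_ : (fun i t => _) = (fun i t => omega i t))//.
  by apply/funext => i; apply/funext => t; rewrite /= /W tnth_mktuple.
move=> t x y; rewrite innerE mulr_sumr; apply: eq_bigr => i _.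
have linE (z : 'cV[R]_n) : (Omega t *m z) i ord0 =
    (Num.sqrt s%:R)^-1 * lin (fun j => z j ord0) (tnth (W t) i).
  rewrite OmE -scalemxAl mxE mxE; congr (_ * _); apply: eq_bigr => j _.
  by rewrite !mxE tnth_mktuple mulrC.
rewrite !linE mulrACA; congr (_ * _).
by rewrite -invfM -expr2 sqr_sqrtr// ler0n.
Qed.

End sketch.

Theorem proposition4p1 (R : realType) (d : measure_display)
    (T : measurableType d) (P : probability T R) (s n : nat)
    (x y : 'cV[R]_n) (Omega : T -> 'M[R]_(s, n)) (delta : R) :
  enorm x = 1 -> enorm y = 1 ->
  gaussian_sketching_matrix P Omega ->
  (2 <= s)%N -> 0 < delta ->
  (x <> y ->
     (P [set t | (`|inner (Omega t *m x) (Omega t *m y)| <= delta)%R]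
        <= (202 * s%:R * delta)%R%:E)%E) /\
  (x = y -> delta <= 1 ->
     (P [set t | (`|inner (Omega t *m x) (Omega t *m y)| <= delta)%R]
        <= ((delta * expR (1 - delta)) `^ (s%:R / 2))%R%:E)%E).
Proof.
move=> x1 y1 /sketch_law[W [law innE]] s2 d0.
have {}x1 := enorm1_sqr _ _ x1; have {}y1 := enorm1_sqr _ _ y1.
pose X j : R := x j ord0; pose Y j : R := y j ord0.
have s0 : 0 < s%:R :> R by rewrite ltr0n (leq_trans _ s2).
split=> [_|yx d1].
- have [u [v [uv0 u2 quadE]]] := quad_polarization n X Y x1 y1.
  case: s Omega s2 s0 W law innE => [//|[//|s]] Omega _ s0 W law innE.
  (* [4] from polarization and [s] from the scaling of the sketch. *)
  pose e := 4 * s.+2%:R * delta.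
  have e0 : 0 < e by rewrite !mulr_gt0.
  pose A := [set w : s.+2.-tuple (n.-tuple R) |
    `[(- e)%R, e]%classic (\sum_(i < s.+2) quad u v (tnth w i))].
  have mA : measurable A.
    rewrite -[A]setTI; apply: (measurable_sum_iid s.+2 (quad u v)) => //.
    exact: measurable_quad.
  rewrite (_ : [set t | _] = W @^-1` A).
    rewrite law//; apply: (@le_trans _ _ (2 * e)%:E).
      apply: (iid_sum_le (iid (normal_prob 0 1) n) s (quad u v)
        `[(- e)%R, e]%classic (2 * e) (measurable_quad n u v) _
        (fun c => quad_anticoncentration n u v e c e0 uv0 u2)).
      exact: measurable_itv.
    by rewrite lee_fin /e; have := mulr_gt0 s0 d0; nra.
  apply/seteqP; split => t; rewrite /A/= in_itv/= -ler_norml quadE innE normrM;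
    by rewrite ger0_norm ?invr_ge0// ler_pdivrMl// /e -mulrA ler_pM2l.
- subst y.
  pose A := [set w : s.-tuple (n.-tuple R) |
    \sum_(i < s) lin X (tnth w i) ^+ 2 <= s%:R * delta].
  have mA : measurable A.
    rewrite -[A]setTI.
    rewrite (_ : A = (fun w : s.-tuple (n.-tuple R) =>
      \sum_(i < s) lin X (tnth w i) ^+ 2)%R @^-1` `]-oo, (s%:R * delta)%R]%classic).
      apply: (measurable_sum_iid s (fun w => lin X w ^+ 2)) => //.
      by apply: measurable_funX; exact: measurable_lin.
    by apply/seteqP; split => w /=; rewrite in_itv.
  rewrite (_ : [set t | _] = W @^-1` A).
    by rewrite law//; exact: lin_chernoff.
  have sq t : \sum_(i < s) lin X (tnth (W t) i) * lin X (tnth (W t) i) =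
      \sum_(i < s) lin X (tnth (W t) i) ^+ 2.
    by apply: eq_bigr => i _; rewrite expr2.
  have sq0 t : 0 <= \sum_(i < s) lin X (tnth (W t) i) ^+ 2.
    by apply: sumr_ge0 => i _; rewrite sqr_ge0.
  by apply/seteqP; split => t;
    rewrite /A/= innE sq ger0_norm ?mulr_ge0 ?invr_ge0// ler_pdivrMl.
Qed.
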